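(* Let $X$ be a weakly $\mathfrak{c}$-dissipated compact space. Then every Radon measure on $X$ is separable.
   Context: All spaces are Hausdorff; $f:X\to Y$ always denotes a continuous map. A subset of a space is perfect iff it is closed, non-empty and has no isolated points; a space is scattered iff it has no perfect subsets. Let $X,Y$ be compact and $f:X\to Y$. A strongly $\mathfrak{c}$-loose function for $f$ is a continuous map $\varphi:\mathrm{dom}(\varphi)\to 2^\omega$ (the Cantor set), with $\mathrm{dom}(\varphi)$ closed in $X$, such that for some non-scattered $Q\subseteq Y$ we have $\varphi(f^{-1}\{y\}\cap \mathrm{dom}(\varphi))=2^\omega$ for all $y\in Q$. The map $f$ is weakly $\mathfrak{c}$-tight iff there is no strongly $\mathfrak{c}$-loose function for $f$. For compact $X,Y,Z$, $f:X\to Y$ and $g:X\to Z$, $f$ is finer than $g$ iff there is a continuous $\Gamma:f(X)\to g(X)$ with $g=\Gamma\circ f$. $X$ is weakly $\mathfrak{c}$-dissipated iff $X$ is compact and whenever $g:X\to Z$ with $Z$ compact metrizable, there is a weakly $\mathfrak{c}$-tight $f:X\to Y$, for some compact metrizable $Y$, that is finer than $g$. A Radon measure on a compact space is a finite positive regular Borel measure. A measure $\mu$ is separable iff $L^p(\mu)$ is a separable metric space for some (equivalently, all) $p\in[1,\infty)$. *)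

(* Defs.v *)
From HB Require Import structures.
From mathcomp Require Import all_boot all_order all_algebra.
From mathcomp Require Import all_classical all_reals all_analysis.
Import Order.TTheory GRing.Theory Num.Theory.
Import numFieldNormedType.Exports.

Set Implicit Arguments.
Unset Strict Implicit.
Unset Printing Implicit Defensive.

Local Open Scope classical_set_scope.
Local Open Scope ring_scope.

(* The library's [perfect_set] allows the empty set. *)
Definition perfect (T : topologicalType) (A : set T) : Prop :=
  [/\ closed A, A !=set0 & isolated A = set0].

Definition scattered (T : topologicalType) : Prop :=
  ~ exists A : set T, perfect A.

(* [phi] is a function on the closed set [D]; its values outside [D] are junk.
   [Q] is viewed as a space of its own, so that the perfect set witnessing
   non-scatteredness is closed relatively to [Q]. *)
Definition strongly_c_loose (X Y : topologicalType) (f : X -> Y)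
    (D : set X) (phi : X -> cantor_space) : Prop :=
  [/\ closed D, {within D, continuous phi} &
      exists2 Q : set Y, ~ scattered (set_type Q) &
        forall y, Q y -> phi @` (f @^-1` [set y] `&` D) = [set: cantor_space]].

Definition weakly_c_tight (X Y : topologicalType) (f : X -> Y) : Prop :=
  ~ exists D : set X, exists phi : X -> cantor_space, strongly_c_loose f D phi.

Definition finer (X Y Z : topologicalType) (f : X -> Y) (g : X -> Z) : Prop :=
  exists2 Gamma : set_type (range f) -> set_type (range g),
    continuous Gamma &
    forall x, g x = set_val (Gamma (SigSub (mem_range f x))).

(* A compact metrizable space is given as a compact [metricType]; only its
   topology is used. *)
Definition weakly_c_dissipated (R : realType) (X : topologicalType) : Prop :=
  compact [set: X] /\
  forall (Z : metricType R) (g : X -> Z),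
    compact [set: Z] -> continuous g ->
    exists (Y : metricType R) (f : X -> Y),
      [/\ compact [set: Y], continuous f, weakly_c_tight f & finer f g].

Notation borel_type X := (g_sigma_algebraType (@open X)).

Definition regular_measure (R : realType) (X : ptopologicalType)
    (mu : {measure set (borel_type X) -> \bar R}) : Prop :=
  forall A : set (borel_type X), measurable A ->
    mu A = ereal_sup [set mu K | K in [set K : set X | compact K /\ K `<=` A]]
    /\
    mu A = ereal_inf [set mu U | U in [set U : set X | open U /\ A `<=` U]].

(* [LspaceType mu p1] (the quotient modulo equality mu-almost everywhere)
   carries no metric in the library: the distance is [Lp_dist]. *)
Definition Lp_dist (d : measure_display) (T : measurableType d) (R : realType)
    (mu : {measure set T -> \bar R}) (p : \bar R) (p1 : (1 <= p)%E)
    (f g : LspaceType mu p1) : \bar R :=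
  'N[mu]_p[EFin \o ((f : T -> R) \- (g : T -> R))%R]%E.

Definition separable_Lp (d : measure_display) (T : measurableType d)
    (R : realType) (mu : {measure set T -> \bar R})
    (p : \bar R) (p1 : (1 <= p)%E) : Prop :=
  exists2 D : set (LspaceType mu p1), countable D &
    forall (f : LspaceType mu p1) (e : R), 0 < e ->
      exists2 g, D g & (Lp_dist f g < e%:E)%E.

Definition separable_measure (d : measure_display) (T : measurableType d)
    (R : realType) (mu : {measure set T -> \bar R}) : Prop :=
  exists (p : R) (p1 : (1 <= p%:E)%E), separable_Lp mu p1.

(* Main.v *)
Require Import Defs.
From HB Require Import structures.
From mathcomp Require Import all_boot all_order all_algebra.
From mathcomp Require Import all_classical all_reals all_analysis.
From mathcomp Require Import measurable_realfun ring lra.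
Import Order.TTheory GRing.Theory Num.Theory.
Import numFieldNormedType.Exports.

Set Implicit Arguments.
Unset Strict Implicit.
Unset Printing Implicit Defensive.

Local Open Scope classical_set_scope.
Local Open Scope ring_scope.

(** Call a measurable set essentially countably generated if all its measurable
    subsets lie, up to null sets, in a countably generated sigma-algebra; if the
    whole space is so, then [L^1] is separable.  Otherwise exhaustion yields a
    non-null [H] none of whose non-null subsets is essentially countably
    generated.  Being atomless, [H] contains a non-null compact [K] on which some
    continuous map to [[0, 1]] has null fibres; take a weakly c-tight
    [f : X -> Y] finer than this map.  Say that [A] is full over a set [B] of the
    sigma-algebra generated by [f] when every non-null part of [B] in that
    sigma-algebra meets [A] in a non-null set.  A subset of [K] that is full over
    [B] splits into two disjoint sets full over [B], since otherwise the
    sigma-algebra of [f] would generate the subsets of a non-null part of it.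
    Shrinking to compact sets at the cost of a small part of [B] and iterating
    produces a binary tree of compact sets [K_s] such that the intersection [Q]
    of the [f(K_s)] has a non-null preimage in [K]; as the fibres are null, [Q]
    is uncountable, hence not scattered, and the tree codes a map onto the Cantor
    space that is strongly c-loose for [f], a contradiction. *)

(** * Countable sets *)

Lemma countable_setU (T : Type) (A B : set T) :
  countable A -> countable B -> countable (A `|` B).
Proof.
by move=> cA cB; rewrite -bigcup2E; apply: bigcup_countable => // -[|[|n]] _ /=.
Qed.

Lemma countable_enum (I : Type) (D : set I) : countable D ->
  D = set0 \/ exists e : nat -> I, D = range e.
Proof.
move=> /countable_injP[k kinj].
have [->|/set0P[i0 Di0]] := eqVneq D set0; [by left|right].
have /choice[e eP] n : exists i, D i /\
    ((exists2 j, D j & k j = n) -> k i = n).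
  have [[j Dj kj]|nj] := pselect (exists2 j, D j & k j = n).
    by exists j; split.
  by exists i0; split.
exists e; apply/seteqP; split => [i Di|_ [n _ <-]]; last exact: (eP n).1.
exists (k i) => //; apply: kinj; rewrite ?inE//; first exact: (eP (k i)).1.
by apply: (eP (k i)).2; exists i.
Qed.

(** * Exhaustion and essentially countably generated sets *)

Section exhaustion.
Context (d : measure_display) (T : measurableType d) (R : realType).
Variable mu : {finite_measure set T -> \bar R}.

(** Sets of [C] whose measures approach the supremum have a union [M] in [C] that attains it. Adding
    any [A] of [C] to [M] stays in [C], so it adds no measure. *)
Lemma exhaustion (C : set (set T)) : C set0 -> C `<=` measurable ->
    (forall F : nat -> set T, (forall n, C (F n)) -> C (\bigcup_n F n)) ->
  exists2 M, C M & forall A, C A -> mu.-negligible (A `\` M).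
Proof.
move=> C0 Cm Cbigcup.
pose s := ereal_sup (mu @` C).
have s_fin : s \is a fin_num.
  apply/fin_numPlt/andP; split.
    rewrite (@lt_le_trans _ _ 0%E)//.
    by apply: ereal_sup_ubound; exists set0; rewrite ?measure0.
  apply: (@le_lt_trans _ _ (mu setT)); last first.
    by rewrite -ge0_fin_numE//; exact: fin_num_measure.
  apply: ge_ereal_sup => _ [A CA <-].
  by apply: le_measure; rewrite ?inE//; exact: Cm.
have /choice[F FP] n : exists A, C A /\ (s - (n.+1%:R^-1)%:E < mu A)%E.
  have [|_ [A CA <-] sA] := @ub_ereal_sup_adherent _ (mu @` C) n.+1%:R^-1 _ s_fin.
    by [].
  by exists A.
pose M := \bigcup_n F n.
have CM : C M by apply: Cbigcup => n; exact: (FP n).1.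
have sM : (s <= mu M)%E.
  apply/lee_addgt0Pr => e e0.
  have [n ne] := ltr_add_invr e0; rewrite add0r in ne.
  rewrite -leeBlDr//; apply: (@le_trans _ _ (s - (n.+1%:R^-1)%:E)%E).
    by rewrite leeB// lee_fin ltW.
  apply: (le_trans (ltW (FP n).2)); apply: le_measure; rewrite ?inE.
  - by apply: Cm; exact: (FP n).1.
  - exact: Cm.
  - exact: bigcup_sup.
exists M => // A CA.
have mA := Cm _ CA; have mM := Cm _ CM.
have CAM : C (M `|` A).
  rewrite -bigcup2E; apply: Cbigcup => -[//|[//|n]] /=; exact: C0.
have MAs : (mu (M `|` A) <= s)%E by apply: ereal_sup_ubound; exists (M `|` A).
have := le_trans MAs sM.
have -> : M `|` A = M `|` (A `\` M).
  by apply/seteqP; split => x /=; have := pselect (M x); tauto.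
have mAM : measurable (A `\` M) by exact: measurableD.
rewrite measureU//; last by rewrite setDE setICA setICr setI0.
move=> h; apply/negligibleP => //; apply/eqP; rewrite eq_le measure_ge0 andbT.
by move: h; rewrite -leeBrDl ?fin_num_measure// subee// fin_num_measure.
Qed.

Definition ess_countably_generated (S : set T) :=
  exists F : set (set T), [/\ countable F, F `<=` measurable &
    forall E, measurable E -> E `<=` S ->
      exists2 B, <<s F >> B & mu.-negligible (E `+` B)].

Definition nowhere_countably_generated (H : set T) :=
  forall A, measurable A -> A `<=` H -> ess_countably_generated A ->
  mu.-negligible A.

Lemma sigma_sub_measurable (F : set (set T)) : F `<=` measurable ->
  <<s F >> `<=` measurable.
Proof. by move=> Fm; apply: smallest_sub => //; exact: sigma_algebra_measurable. Qed.

(** The union of the generating families works: the parts of [E] in the sets [S n] are approximated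
    separately, and the countably many null errors add up to a null set. *)
Lemma ess_countably_generated_bigcup (S : nat -> set T) :
    (forall n, measurable (S n)) ->
    (forall n, ess_countably_generated (S n)) ->
  ess_countably_generated (\bigcup_n S n).
Proof.
move=> mS /choice[F FP]; exists (\bigcup_n F n); split.
- by apply: bigcup_countable => // n _; have [] := FP n.
- by move=> A [n _]; have [_ + _] := FP n; exact.
- move=> E mE ES.
  have /choice[B BP] n : exists B, <<s F n >> B /\
      mu.-negligible ((E `&` S n) `+` B).
    have [_ _ /(_ (E `&` S n))[||B BF BE]] := FP n; last by exists B.
    - exact: measurableI.
    - by move=> x [].
  exists (\bigcup_n B n).
    apply: sigma_algebra_bigcup => n.
    by apply: sub_sigma_algebra2 (BP n).1; exact: bigcup_sup.
  apply: (@negligibleS _ _ _ _ (\bigcup_n ((E `&` S n) `+` B n))).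
    move=> x [[Ex nBx]|[[n _ Bx] nEx]].
      have [n _ Sx] := ES _ Ex; exists n => //; left; split => //.
      by apply: contra_not nBx => Bx; exists n.
    by exists n => //; right; split => // -[].
  by apply: negligible_bigcup => n; exact: (BP n).2.
Qed.

Lemma ess_countably_generated_negligible (A : set T) :
  mu.-negligible A -> ess_countably_generated A.
Proof.
move=> A0; exists set0; split => // E mE EA; exists set0.
  exact: sigma_algebra0.
by rewrite setY0; exact: negligibleS EA A0.
Qed.

Lemma nowhere_countably_generatedS (A B : set T) : A `<=` B ->
  nowhere_countably_generated B -> nowhere_countably_generated A.
Proof. by move=> AB nB E mE EA; apply: nB => //; exact: subset_trans AB. Qed.

(** Exhaustion gives an essentially countably generated [M] that is largest up to null sets. Its
    complement is [H]: were it null, the whole space would be essentially countably generated. *)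
Lemma nowhere_countably_generated_exists :
    ~ ess_countably_generated [set: T] ->
  exists H, [/\ measurable H, ~ mu.-negligible H &
    nowhere_countably_generated H].
Proof.
move=> nT.
have [|||M [mM cM] MP] :=
    @exhaustion [set A | measurable A /\ ess_countably_generated A].
- split => //; apply: ess_countably_generated_negligible.
  exact: negligible_set0.
- by move=> A [].
- move=> F FP; split; first by apply: bigcup_measurable => n _; exact: (FP n).1.
  by apply: ess_countably_generated_bigcup => n; have [] := FP n.
exists (~` M); split; first exact: measurableC.
- move=> nM; apply: nT; rewrite -(setUv M) -bigcup2E.
  apply: ess_countably_generated_bigcup => -[|[|n]] //=.
  + exact: measurableC.
  + exact: ess_countably_generated_negligible.
  + exact/ess_countably_generated_negligible/negligible_set0.
- move=> A mA AM cA; have := MP A (conj mA cA); congr (mu.-negligible _).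
  by rewrite setDE; apply/setIidPl.
Qed.

(** If every measurable part of [A] were null or conull in [A], the single generator [A] would
    suffice. *)
Lemma nowhere_countably_generated_split (A : set T) : measurable A ->
    nowhere_countably_generated A -> ~ mu.-negligible A ->
  exists2 E, measurable E & [/\ E `<=` A, ~ mu.-negligible E &
    ~ mu.-negligible (A `\` E)].
Proof.
move=> mA nA A0; apply: contrapT => nE; apply: A0; apply: nA => //.
exists [set A]; split; first exact: countable1.
  by move=> _ ->.
move=> E mE EA.
have [E0|E0] := pselect (mu.-negligible E).
  by exists set0; [exact: sigma_algebra0|rewrite setY0].
exists A; first exact: sub_sigma_algebra.
have AE : mu.-negligible (A `\` E).
  by apply: contrapT => AE; apply: nE; exists E.
by apply: negligibleS AE => x [[/EA]|].
Qed.

(** Splitting repeatedly and keeping the smaller piece at least halves the measure at each round. *)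
Lemma nowhere_countably_generated_small (A : set T) (e : R) : measurable A ->
    nowhere_countably_generated A -> ~ mu.-negligible A -> (0 < e)%R ->
  exists2 E, measurable E & [/\ E `<=` A, ~ mu.-negligible E & (mu E < e%:E)%E].
Proof.
move=> mA nA A0 e0.
have halving n : exists2 E, measurable E & [/\ E `<=` A, ~ mu.-negligible E &
    (mu E <= (fine (mu A) * 2^-1 ^+ n)%:E)%E].
  elim: n => [|n [E mE [EA E0 muE]]].
    by exists A => //; split => //; rewrite expr0 mulr1 fineK// fin_num_measure.
  have nE := nowhere_countably_generatedS EA nA.
  have [D mD [DE D0 ED0]] := nowhere_countably_generated_split mE nE E0.
  have : (mu D + mu (E `\` D) <= (fine (mu A) * 2^-1 ^+ n)%:E)%E.
    apply: le_trans muE; rewrite -measureU//; last 2 first.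
      exact: measurableD.
      by rewrite setDE setICA setICr setI0.
    apply: le_measure; rewrite ?inE//; last by move=> x [/DE|[]].
    by apply: measurableU => //; exact: measurableD.
  have mED : measurable (E `\` D) by exact: measurableD.
  have [fD fED] : mu D \is a fin_num /\ mu (E `\` D) \is a fin_num.
    by split; exact: fin_num_measure.
  have [le h|le h] := leP (mu D) (mu (E `\` D)).
    exists D => //; split => //; first exact: subset_trans EA.
    move: le h; rewrite -(fineK fD) -(fineK fED) -EFinD !lee_fin exprSr.
    by move: (fine _) (fine _) (_ ^+ _) => a b c; lra.
  exists (E `\` D) => //; split => //; first by move=> x [/EA].
  move: le h; rewrite -(fineK fD) -(fineK fED) -EFinD !lee_fin lte_fin exprSr.
  by move: (fine _) (fine _) (_ ^+ _) => a b c; lra.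
have : (fine (mu A) * 2^-1 ^+ n)%R @[n --> \oo] --> (0 : R)%R.
  by apply: cvg_geometric; rewrite ger0_norm// invf_lt1// ltr1n.
move=> /cvgrPdist_lt/(_ e e0)[N _ /(_ N (leqnn N))]; rewrite sub0r normrN => hN.
have [E mE [EA E0 muE]] := halving N.
exists E => //; split => //; apply: (le_lt_trans muE); rewrite lte_fin.
exact: le_lt_trans (ler_norm _) hN.
Qed.

(** Exhaustion by countable unions of sets of measure below [e]: a non-null remainder would contain
    another such set. *)
Lemma nowhere_countably_generated_cover (H : set T) (e : R) : measurable H ->
    nowhere_countably_generated H -> (0 < e)%R ->
  exists E : nat -> set T, [/\ forall n, measurable (E n),
    forall n, (mu (E n) < e%:E)%E & mu.-negligible (H `\` \bigcup_n E n)].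
Proof.
move=> mH nH e0.
have [|||_ [E [mE muE ->]] EP] := @exhaustion [set M | exists E : nat -> set T,
  [/\ forall n, measurable (E n), forall n, (mu (E n) < e%:E)%E &
      M = \bigcup_n E n]].
- by exists (fun=> set0); split => [n|n|]; rewrite ?bigcup0// measure0 lte_fin.
- by move=> _ [E [mE _ ->]]; apply: bigcup_measurable => n _; exact: mE.
- move=> F /choice[E EP].
  (* Indices that code no pair fall back to [E 0 0], which is harmless in a union. *)
  exists (fun n => let: (i, j) := odflt (0, 0)%N (unpickle n) in E i j); split.
  + by move=> n; case: (odflt _ _) => i j; have [+ _ _] := EP i; exact.
  + by move=> n; case: (odflt _ _) => i j; have [_ + _] := EP i; exact.
  + apply/seteqP; split => x [n _].
      have [_ _ ->] := EP n => -[j _ Ex].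
      by exists (pickle (n, j)) => //; rewrite pickleK.
    case: (odflt _ _) => i j Ex; exists i => //.
    by have [_ _ ->] := EP i; exists j.
exists E; split => //; set M := \bigcup_n E n.
have mM : measurable M by apply: bigcup_measurable => n _; exact: mE.
have mHM : measurable (H `\` M) by exact: measurableD.
apply: contrapT => HM0.
have nHM : nowhere_countably_generated (H `\` M).
  by apply: nowhere_countably_generatedS nH => x [].
have [D mD [DHM D0 muD]] := nowhere_countably_generated_small mHM nHM HM0 e0.
apply: D0; have := EP D.
have -> : D `\` M = D by rewrite setDE; apply/setIidPl => x /DHM[].
apply; exists (fun=> D); split => //.
by apply/seteqP; split => x; [exists 0%N|move=> []].
Qed.

End exhaustion.

(** * Sets full over a sub-sigma-algebra *)

Section fullness.
Context (d : measure_display) (T : measurableType d) (R : realType).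
Variable mu : {finite_measure set T -> \bar R}.
Variable F : set (set T).
Hypothesis countableF : countable F.
Hypothesis measurableF : F `<=` measurable.

(* When [F] generates the preimage under [f] of the Borel sets of [Y], this
   says that [f] maps the part of [A] above [B] essentially onto [B]. *)
Definition full_over (A B : set T) := forall C, <<s F >> C -> C `<=` B ->
  mu.-negligible (A `&` C) -> mu.-negligible C.

Let sFC A : <<s F >> A -> <<s F >> (~` A).
Proof. exact: (@measurableC _ (g_sigma_algebraType F)). Qed.

Let sFI A B : <<s F >> A -> <<s F >> B -> <<s F >> (A `&` B).
Proof. exact: (@measurableI _ (g_sigma_algebraType F)). Qed.

Let sFD A B : <<s F >> A -> <<s F >> B -> <<s F >> (A `\` B).
Proof. exact: (@measurableD _ (g_sigma_algebraType F)). Qed.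

Let sFm := sigma_sub_measurable measurableF.

Lemma full_overS (A A' B B' : set T) : A `<=` A' -> B' `<=` B ->
  full_over A B -> full_over A' B'.
Proof.
move=> AA BB AB C sC CB A'C; apply: AB => //; first exact: subset_trans BB.
by apply: negligibleS A'C => x [/AA].
Qed.

(** By exhaustion, [N] is the largest set of the sigma-algebra, up to null sets, that meets [A] in a
    null set. *)
Lemma full_over_setC (A : set T) :
  exists N, [/\ <<s F >> N, mu.-negligible (A `&` N) & full_over A (~` N)].
Proof.
have [|||N [sN AN] NP] :=
    @exhaustion _ _ _ mu [set N | <<s F >> N /\ mu.-negligible (A `&` N)].
- by split; [exact: sigma_algebra0|rewrite setI0; exact: negligible_set0].
- by move=> N [/sFm].
- move=> G GP; split; first by apply: sigma_algebra_bigcup => n; exact: (GP n).1.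
  by rewrite setI_bigcupr; apply: negligible_bigcup => n; exact: (GP n).2.
exists N; split => // C sC CN AC; have := NP C (conj sC AC).
by congr (mu.-negligible _); rewrite setDE; apply/setIidPl.
Qed.

Let splits (A D : set T) := exists A0 A1 : set T,
  [/\ measurable A0, measurable A1, A0 `<=` A & A1 `<=` A] /\
  [/\ A0 `&` A1 = set0, full_over A0 D & full_over A1 D].

(** The sets [D n] are first made disjoint by [seqDU], so that splittings chosen over different
    [D n] stay disjoint when glued. *)
Let splits_bigcup A (D : nat -> set T) : (forall n, <<s F >> (D n)) ->
  (forall n, splits A (D n)) -> splits A (\bigcup_n D n).
Proof.
move=> sD /choice[A0 /choice[A1 AP]]; pose G := seqDU D.
have sG n : <<s F >> (G n).
  exact: (@seqDU_measurable _ (g_sigma_algebraType F)).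
have mA0 n : measurable (A0 n) by have [[]] := AP n.
have mA1 n : measurable (A1 n) by have [[]] := AP n.
have full (B : nat -> set T) : (forall n, full_over (B n) (D n)) ->
    full_over (\bigcup_n (B n `&` G n)) (\bigcup_n D n).
  move=> BD C sC CD BC.
  apply: (@negligibleS _ _ _ _ (\bigcup_n (C `&` G n))).
    move=> x Cx; have := CD _ Cx; rewrite seqDU_bigcup_eq => -[n _ Gx].
    by exists n.
  apply: negligible_bigcup => n; apply: (BD n); first exact: sFI.
    by move=> x [_]; exact: subset_seqDU.
  by apply: negligibleS BC => x [Bx [Cx Gx]]; split => //; exists n.
exists (\bigcup_n (A0 n `&` G n)), (\bigcup_n (A1 n `&` G n)); split; split.
- by apply: bigcup_measurable => n _; apply: measurableI => //; exact: sFm.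
- by apply: bigcup_measurable => n _; apply: measurableI => //; exact: sFm.
- by move=> x [n _ [A0x _]]; have [[_ _ + _] _] := AP n; exact.
- by move=> x [n _ [A1x _]]; have [[_ _ _ +] _] := AP n; exact.
- apply/seteqP; split => // x [[n _ [A0x Gn]] [m _ [A1x Gm]]].
  have nm : n = m.
    by apply: (@trivIset_seqDU _ D) => //; exists x.
  have [_ [A01 _ _]] := AP n; rewrite -A01; split => //.
  by rewrite nm.
- by apply: full => n; have [_ []] := AP n.
- by apply: full => n; have [_ []] := AP n.
Qed.

(** Exhaustion gives a largest part [M] of [B] over which [A] splits. If the rest were non-null,
    some [E] in the part of [A] above it would be no trace of the sigma-algebra; [E] and its
    complement there then split [A] over a further non-null set. *)
Lemma full_over_split (A B : set T) : measurable A ->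
    nowhere_countably_generated mu A -> <<s F >> B -> full_over A B ->
  exists A0 A1 : set T,
  [/\ measurable A0, measurable A1, A0 `<=` A & A1 `<=` A] /\
  [/\ A0 `&` A1 = set0, full_over A0 B & full_over A1 B].
Proof.
move=> mA nA sB AB.
have [|||M [sM MB splitM] MP] := @exhaustion _ _ _ mu
    [set D | [/\ <<s F >> D, D `<=` B & splits A D]].
- split => //; first exact: sigma_algebra0.
  have full0 : full_over set0 set0.
    by move=> C sC; rewrite subset0 => -> _; exact: negligible_set0.
  by exists set0, set0; split; split => //; rewrite setI0.
- by move=> D [/sFm].
- move=> G GP; split.
  + by apply: sigma_algebra_bigcup => n; have [] := GP n.
  + by apply: bigcup_sub => n _; have [] := GP n.
  + by apply: splits_bigcup => n; have [] := GP n.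
suff BM0 : mu.-negligible (B `\` M).
  have full D : full_over D M -> full_over D B.
    move=> DM C sC CB DC; apply: (@negligibleS _ _ _ _ ((C `&` M) `|` (B `\` M))).
      by move=> x Cx; have Bx := CB _ Cx; have [?|?] := pselect (M x); [left|right].
    apply: negligibleU => //; apply: DM; first exact: sFI.
      by move=> x [].
    by apply: negligibleS DC => x [? []].
  have [A0 [A1 [h [A01 /full ? /full ?]]]] := splitM.
  by exists A0, A1.
apply: contrapT => BM0.
pose A' := A `&` (B `\` M).
have mA' : measurable A' by apply: measurableI => //; apply: sFm; exact: sFD.
have A'0 : ~ mu.-negligible A'.
  apply: contra_not BM0 => A'0; exact: (AB _ (sFD sB sM) (@subDsetl _ _ _) A'0).
(* Otherwise [F] together with [A'] would generate the subsets of [A'] up to null sets. *)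
have [E mE [EA' nE]] : exists2 E, measurable E & E `<=` A' /\
    forall D, <<s F >> D -> ~ mu.-negligible (E `+` (A' `&` D)).
  apply: contrapT => noE; apply: A'0; apply: nA => //; first by move=> x [].
  exists (A' |` F); split.
  - exact: countable_setU (countable1 _) countableF.
  - by move=> D [->|/measurableF].
  - move=> E mE EA'; apply: contrapT => nE; apply: noE; exists E => //.
    split => // D sD ED; apply: nE; exists (A' `&` D) => //.
    apply: (@measurableI _ (g_sigma_algebraType (A' |` F))).
      by apply: sub_sigma_algebra; left.
    by apply: sub_sigma_algebra2 sD => ? ?; right.
have [N0 [sN0 EN0 fullN0]] := full_over_setC E.
have [N1 [sN1 EN1 fullN1]] := full_over_setC (A' `\` E).
(* [E] is full off [N0], and its complement in [A'] is full off [N1]. Were the remaining [D] null,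
   [E] would be the trace of [N1] on [A'] up to a null set. *)
pose D := ((B `\` M) `\` N0) `\` N1.
have sD : <<s F >> D by do !apply: sFD.
have D0 : ~ mu.-negligible D.
  move=> D0; apply: (nE _ sN1).
  apply: (@negligibleS _ _ _ _ ((E `&` N0) `|` ((A' `\` E) `&` N1) `|` D)).
    move=> x [[Ex nAN1]|[[A'x N1x] nEx]]; last by left; right.
    have A'x := EA' _ Ex; have nN1 : ~ N1 x by apply: contra_not nAN1.
    have [N0x|nN0] := pselect (N0 x); first by left; left.
    by right; split => //; split => //; case: A'x.
  by apply: negligibleU => //; exact: negligibleU.
apply: D0; have -> : D = D `\` M.
  by apply/seteqP; split => x; [move=> [[[]]]|case].
apply: MP; split => //; first by move=> x [[[]]].
exists E, (A' `\` E); split; split => //.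
- exact: measurableD.
- by move=> x /EA'[].
- by move=> x [[]].
- by rewrite setDE setICA setICr setI0.
- by apply: full_overS fullN0 => // x [[]].
- by apply: full_overS fullN1 => // x [].
Qed.

Variable K : set (set T).
Hypotheses (K0 : K set0) (KU : setU_closed K) (measurableK : K `<=` measurable).
Hypothesis innerK : forall (A : set T) (e : R), measurable A -> 0 < e ->
  exists2 L, K L & L `<=` A /\ (mu (A `\` L) < e%:E)%E.

(** [P n] is the part of [B] that each of [L 0], ..., [L n] misses up to null sets. These parts
    decrease to a null set because [A] is full over [B]; so some [P n] is small, and the union of
    [L 0], ..., [L n] is full over the rest. *)
Lemma full_over_inner (A B : set T) (e : R) : measurable A -> <<s F >> B ->
    full_over A B -> 0 < e ->
  exists L B' : set T, [/\ K L, L `<=` A, <<s F >> B' & B' `<=` B] /\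
    full_over L B' /\ (mu (B `\` B') < e%:E)%E.
Proof.
move=> mA sB AB e0.
have /choice[L LP] n : exists L, K L /\ L `<=` A /\
    (mu (A `\` L) < n.+1%:R^-1%:E)%E.
  by have [|L KL ?] := @innerK A n.+1%:R^-1 mA _; last by exists L.
have mL n : measurable (L n) by apply: measurableK; exact: (LP n).1.
have /choice[N NP] n := full_over_setC (L n).
have mN n : measurable (N n) by apply: sFm; have [] := NP n.
pose P n := B `&` \bigcap_(i in `I_n.+1) N i.
have sP n : <<s F >> (P n).
  apply: sFI => //; apply: (@bigcap_measurable _ (g_sigma_algebraType F)).
    by exists 0%N.
  by move=> i _; have [] := NP i.
have sPoo : <<s F >> (\bigcap_n P n).
  apply: (@bigcap_measurable _ (g_sigma_algebraType F)); first by exists 0%N.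
  by move=> n _; exact: sP.
(* For each [n], a point of [A] in the intersection lies either in both [L n] and [N n], a null set,
   or in [A] outside [L n], a set of measure below [1/(n+1)]. *)
have Poo : mu.-negligible (\bigcap_n P n).
  apply: AB => //.
    by move=> x /(_ 0%N I)[].
  have mAP : measurable (A `&` \bigcap_n P n).
    by apply: measurableI => //; exact: sFm.
  apply/negligibleP => //; apply/eqP; rewrite eq_le measure_ge0 andbT.
  apply/lee_addgt0Pr => r r0; rewrite add0e.
  have [n ne] := ltr_add_invr r0; rewrite add0r in ne.
  have [_ LN _] := NP n.
  have mLN : measurable (L n `&` N n) by exact: measurableI.
  have mAL : measurable (A `\` L n) by exact: measurableD.
  apply: (@le_trans _ _ (mu ((A `\` L n) `|` (L n `&` N n)))).
    apply: le_measure; rewrite ?inE//; first exact: measurableU.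
    move=> x [Ax /(_ n I)[_ /(_ n (ltnSn n)) Nx]].
    by have [?|?] := pselect (L n x); [right|left].
  rewrite measureU0//; last exact/negligibleP.
  by apply: ltW; apply: lt_trans (LP n).2.2 _; rewrite lte_fin.
have [n Pn] : exists n, (mu (P n) < e%:E)%E.
  have : mu (P n) @[n --> \oo] --> mu (\bigcap_n P n).
    apply: (@nonincreasing_cvg_mu _ _ _ mu P).
    - by rewrite -ge0_fin_numE// fin_num_measure//; exact: sFm.
    - by move=> i; exact: sFm.
    - exact: sFm.
    - move=> m n mn; apply/subsetPset => x [Bx Nx]; split => // i im.
      by apply: Nx; exact: (@leq_trans m.+1 i.+1).
  move/negligibleP : (Poo) => -> //; last exact: sFm.
  move=> /fine_cvgP[_ /cvgrPdist_lt/(_ e e0)[n _ /(_ n (leqnn n))]].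
  rewrite sub0r normrN => h; exists n.
  rewrite -(@fineK _ (mu (P n))) ?fin_num_measure//; last exact: sFm.
  by rewrite lte_fin; exact: le_lt_trans (ler_norm _) h.
exists (\big[setU/set0]_(i < n.+1) L i), (B `\` P n); split; split.
- by apply: big_ind => // i _; exact: (LP i).1.
- rewrite -bigcup_mkord; apply: bigcup_sub => i _; exact: (LP i).2.1.
- exact: sFD.
- by move=> x [].
(* A point of [C] lies outside some [N i] with [i <= n], and [L i] is full off [N i]. *)
- move=> C sC CB LC.
  apply: (@negligibleS _ _ _ _
      (\bigcup_i if (i < n.+1)%N then C `\` N i else set0)).
    move=> x Cx; have [Bx nPx] := CB _ Cx; apply: contrapT => nx.
    apply: nPx; split => // i /= ilt; apply: contrapT => nNx.
    by apply: nx; exists i => //; rewrite ilt.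
  apply: negligible_bigcup => i; case: ifPn => ilt; last exact: negligible_set0.
  have [sN _ +] := NP i; apply; first exact: sFD.
    by move=> x [].
  apply: negligibleS LC => x [Lx [Cx _]]; split => //.
  by rewrite -bigcup_mkord; exists i.
- by apply: le_lt_trans Pn; rewrite setDD; apply: measureIr => //; exact: sFm.
Qed.

End fullness.

(** * Uncountable subsets of second countable spaces *)

(** As in the Cantor-Bendixson theorem, [V] is the union of the basic open sets that meet [Q] in a
    countable set, and the points of [Q] outside [V] form the perfect set. *)
Lemma uncountable_not_scattered (Y : topologicalType) (Q : set Y) :
  @second_countable Y -> ~ countable Q -> ~ scattered (set_type Q).
Proof.
move=> [B cB [Bo Bx]] Qunc; apply; pose S := set_type Q.
pose small (U : set Y) := countable (U `&` Q).
pose V := \bigcup_(U in B `&` small) U.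
have smallV : small V.
  rewrite /small /V setI_bigcupl; apply: bigcup_countable => [|U []//].
  by apply: sub_countable cB; apply: subset_card_le => U [].
have base (s : S) (W : set S) : nbhs s W -> exists2 U, B U & U (set_val s) /\
    forall t : S, U (set_val t) -> W t.
  move=> [_ [[G oG <-] Gs GW]].
  have [U [BU Us] UG] := Bx (set_val s) G (open_nbhs_nbhs (conj oG Gs)).
  by exists U => //; split => // t Ut; apply: GW; exact: UG.
exists [set s : S | ~ V (set_val s)]; split.
- move=> s cls /= [U [BU sU] Us].
  have [|t [nVt Ut]] := cls (set_val @^-1` U).
    by exists (set_val @^-1` U); split => //; exists U => //; exact: Bo.
  by apply: nVt; exists U.
- apply: contrapT => /set0P/negP/negPn/eqP V0; apply: Qunc.
  apply: sub_countable smallV; apply: subset_card_le => q Qq; split => //.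
  apply: contrapT => nVq.
  by have : set0 (SigSub (mem_set Qq) : S) by rewrite -V0.
(* A basic neighbourhood isolating [s] would meet [Q] only in [V] and in [s], hence countably, and
   so would be contained in [V]. *)
- apply/seteqP; split => // s [/set_mem nVs [W sW WV]].
  have [U BU [Us UW]] := base _ _ sW.
  apply: nVs; exists U => //; split => //.
  have cVs : countable ((V `&` Q) `|` [set set_val s]).
    exact: countable_setU smallV (countable1 _).
  apply: sub_countable cVs; apply: subset_card_le => q [Uq Qq].
  have [Vq|nVq] := pselect (V q); [by left|right].
  have : [set s] (SigSub (mem_set Qq) : S).
    by rewrite -WV; split => //; exact: UW.
  by move=> <-.
Qed.

(** * Maps to the unit interval with null fibres *)

Section ternary_code.
Context (R : realType) (X : topologicalType).
Variable h : nat -> X -> R.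
Hypothesis ch : forall n, continuous (h n).
Hypothesis h01 : forall n x, 0 <= h n x <= 1.

(** Partial sums of the ternary series with digits [2 * h i x]; when all [h i x] are 0 or 1, its sum
    is the point of the middle-thirds Cantor set with these digits. *)
Let S n x := \sum_(i < n) (2 * 3^-1 ^+ i.+1) * h i x.

Let pow3 n : 0 < 3^-1 ^+ n :> R. Proof. by rewrite exprn_gt0. Qed.

Let SS n x : S n.+1 x = S n x + 2 * 3^-1 ^+ n.+1 * h n x.
Proof. by rewrite /S big_ord_recr. Qed.

Let S_ler n k x : S n x <= S (n + k) x <= S n x + 3^-1 ^+ n - 3^-1 ^+ (n + k).
Proof.
elim: k => [|k /andP[ih1 ih2]]; first by rewrite addn0; lra.
rewrite addnS SS; have := h01 (n + k) x; have := pow3 (n + k).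
rewrite exprSr; move: ih1 ih2; move: (S _ _) (S _ _) (h _ _) (_ ^+ n) (_ ^+ (n + k)).
by move=> a b c e f; nra.
Qed.

(** The partial sums increase, so the supremum is the sum of the series. *)
Let g x := sup (range (S^~ x)).

Let gS n x : S n x <= g x <= S n x + 3^-1 ^+ n.
Proof.
have ub : ubound (range (S^~ x)) (S n x + 3^-1 ^+ n).
  move=> _ [k _ <-]; have [nk|/ltnW kn] := leqP n k.
    have := S_ler n (k - n) x; rewrite subnKC// => /andP[_].
    by have := pow3 k; lra.
  have := S_ler k (n - k) x; rewrite subnKC// => /andP[+ _].
  by have := pow3 n; lra.
apply/andP; split.
  by apply: ub_le_sup; [exists (S n x + 3^-1 ^+ n)|exists n].
by apply: ge_sup => //; exists (S n x), n.
Qed.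

Let cS n : continuous (S n).
Proof.
elim: n => [|n ih] x.
  rewrite (_ : S 0 = cst 0); first exact: cvg_cst.
  by apply/funext => y; rewrite /S big_ord0.
rewrite (_ : S n.+1 = S n \+ (fun y => 2 * 3^-1 ^+ n.+1 * h n y)); last first.
  by apply/funext => y; rewrite SS.
by apply: cvgD; [exact: ih|apply: cvgMr; exact: ch].
Qed.

(** Uniform convergence gives continuity. At the first digit where two 0-1 codes differ, the gap
    [2 * 3^-1 ^+ n.+1] exceeds the tail, which is at most [3^-1 ^+ n.+1]. *)
Lemma ternary_code : exists g : X -> R, [/\ continuous g,
  forall x, 0 <= g x <= 1 &
  forall x y, (forall n, h n x = 0 \/ h n x = 1) ->
    (forall n, h n y = 0 \/ h n y = 1) -> g x = g y -> forall n, h n x = h n y].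
Proof.
exists g; split.
- move=> x; apply/cvgrPdist_lt => e e0.
  have : 3^-1 ^+ n @[n --> \oo] --> (0 : R).
    by apply: cvg_expr; rewrite ger0_norm// invf_lt1// ltr1n.
  have e3 : 0 < e / 3 by lra.
  move=> /cvgrPdist_lt/(_ _ e3)[n _ /(_ n (leqnn n))].
  rewrite sub0r normrN ger0_norm; last exact/ltW/pow3.
  move=> n3; have /cvgrPdist_lt/(_ _ e3) := @cS n x.
  apply: filterS => y; rewrite !ltr_norml.
  have := gS n x; have := gS n y; move: n3.
  move: (g x) (g y) (S n x) (S n y) (_ ^+ n) => a b c a' b'.
  by move=> ? /andP[? ?] /andP[? ?] /andP[? ?]; apply/andP; split; lra.
- by move=> x; have := gS 0 x; rewrite /S big_ord0 expr0 add0r.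
- move=> x y hx hy gxy.
  have lt n x' y' : S n x' = S n y' -> h n x' = 0 -> h n y' = 1 -> g x' < g y'.
    move=> Sxy hx0 hy1; have := gS n.+1 x'; have := gS n.+1 y'.
    rewrite !SS hx0 hy1 Sxy; have := pow3 n.+1.
    by move: (_ ^+ _) (S _ _) (g _) (g _) => a b c f; lra.
  suff Sxy n : S n x = S n y.
    move=> n; have [hx0|hx1] := hx n; have [hy0|hy1] := hy n.
    - by rewrite hx0.
    - by have := lt _ _ _ (Sxy n) hx0 hy1; rewrite gxy ltxx.
    - by have := lt _ _ _ (esym (Sxy n)) hy0 hx1; rewrite gxy ltxx.
    - by rewrite hx1.
  elim: n => [|n ih]; first by rewrite /S !big_ord0.
  rewrite !SS ih; congr (_ + _ * _).
  have [hx0|hx1] := hx n; have [hy0|hy1] := hy n.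
  - by rewrite hx0.
  - by have := lt _ _ _ ih hx0 hy1; rewrite gxy ltxx.
  - by have := lt _ _ _ (esym ih) hy0 hx1; rewrite gxy ltxx.
  - by rewrite hx1.
Qed.

End ternary_code.

(** The interval is a type of its own, so that it can serve as a compact metric target in
    [weakly_c_dissipated]. *)
Definition unit_itv (R : realType) := {x : R | 0 <= x <= 1}.

Section unit_itv.
Variable R : realType.

HB.instance Definition _ := Choice.on (unit_itv R).

Let dist (x y : unit_itv R) := `|val x - val y|.

Let distxx x : dist x x = 0. Proof. by rewrite /dist subrr normr0. Qed.

Let dist_positivity x y : dist x y = 0 -> x = y.
Proof. by move/normr0_eq0/subr0_eq/val_inj. Qed.

Let distC x y : dist x y = dist y x. Proof. exact: distrC. Qed.

Let dist_triangle y x z : dist x z <= dist x y + dist y z.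
Proof. exact: ler_distD. Qed.

HB.instance Definition _ := @isMetric.Build R (unit_itv R)
  dist distxx dist_positivity distC dist_triangle.

Lemma continuous_unit_itv (X : topologicalType) (g : X -> unit_itv R) :
  continuous (val \o g : X -> R) -> continuous g.
Proof.
move=> cg x; apply/cvg_ballP => e e0.
move/cvgrPdist_lt : (cg x) => /(_ e e0); apply: filterS => y.
by rewrite ballEmdist.
Qed.

Let clamp01 (x : R) : 0 <= Num.max 0 (Num.min x 1) <= 1.
Proof. by rewrite le_max lexx/= ge_max ler01/= ge_min lexx orbT. Qed.

(** The interval is the image of a segment of the line under the continuous retraction [clamp]. *)
Lemma unit_itv_compact : compact [set: unit_itv R].
Proof.
pose clamp (x : R) : unit_itv R :=
  exist (fun y : R => 0 <= y <= 1) _ (clamp01 x).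
have -> : [set: unit_itv R] = clamp @` `[0, 1].
  apply/seteqP; split => // -[x x01] _; exists x => //=.
  apply/val_inj => /=; have /andP[x0 x1] := x01.
  by rewrite min_l// max_r.
apply: continuous_compact; last exact: segment_compact.
apply: continuous_subspaceT; apply: continuous_unit_itv => x.
suff : {for x, continuous ((cst 0 : R -> R^o) \max (idfun \min (cst 1)))} by [].
apply: continuous_max; first exact: cvg_cst.
by apply: continuous_min; [exact: cvg_id|exact: cvg_cst].
Qed.

End unit_itv.

(** * Countable unions and nested compact sets *)

Lemma negligible_countable_bigcup (d : measure_display) (T : measurableType d)
    (R : realType) (mu : {measure set T -> \bar R}) (I : Type) (D : set I)
    (F : I -> set T) : countable D ->
  (forall i, D i -> mu.-negligible (F i)) ->
  mu.-negligible (\bigcup_(i in D) F i).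
Proof.
move=> /countable_enum[->|[e ->]] F0.
  by rewrite bigcup_set0; exact: negligible_set0.
rewrite bigcup_image; apply: negligible_bigcup => n; apply: F0.
by exists n.
Qed.

Lemma sigma_algebra_countable_bigcup (T I : Type) (G : set (set T)) (D : set I)
    (F : I -> set T) : countable D -> (forall i, D i -> <<s G >> (F i)) ->
  <<s G >> (\bigcup_(i in D) F i).
Proof.
move=> /countable_enum[->|[e ->]] FG.
  by rewrite bigcup_set0; exact: sigma_algebra0.
rewrite bigcup_image; apply: sigma_algebra_bigcup => n; apply: FG.
by exists n.
Qed.

Lemma compact_nested (X : topologicalType) (C : nat -> set X) :
    (forall n, C n.+1 `<=` C n) -> (forall n, closed (C n)) ->
    compact (C 0%N) -> (forall n, C n !=set0) ->
  exists x, forall n, C n x.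
Proof.
move=> Cdec Cclosed C0 Cne.
have Cmono m n : (m <= n)%N -> C n `<=` C m.
  elim: n => [|n ih]; first by rewrite leqn0 => /eqP ->.
  rewrite leq_eqVlt => /predU1P[->//|mn].
  by apply: subset_trans (ih mn); exact: Cdec.
pose F : set_system X := filter_from setT C.
have FF : ProperFilter F.
  apply: filter_from_proper => [|n _]; last exact: Cne.
  apply: filter_from_filter; first by exists 0%N.
  move=> i j _ _; exists (maxn i j) => // x Cx.
  by split; [apply: (Cmono i (maxn i j))|apply: (Cmono j (maxn i j))];
    rewrite ?leq_maxl ?leq_maxr.
have FC n : F (C n) by exists n.
have [x [_ Fx]] := C0 F FF (FC 0%N).
by exists x => n; apply: Cclosed => U xU; exact: Fx.
Qed.

(** * Maps with null fibres for a Radon measure *)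

Section radon.
Context (R : realType) (X : ptopologicalType).
Hypothesis hausdorffX : hausdorff_space X.
Hypothesis compactX : compact [set: X].
Variable mu : {finite_measure set (borel_type X) -> \bar R}.
Hypothesis regular_mu : regular_measure mu.

Lemma closed_borel (C : set X) : closed C -> measurable (C : set (borel_type X)).
Proof.
move=> cC; rewrite -[C]setCK; apply: measurableC.
by apply: sub_sigma_algebra; exact: closed_openC.
Qed.

Lemma compact_borel (C : set X) :
  compact C -> measurable (C : set (borel_type X)).
Proof. by move=> cC; apply: closed_borel; exact: compact_closed. Qed.

Lemma regular_measure_inner (A : set (borel_type X)) (e : R) :
    measurable A -> 0 < e ->
  exists2 L : set (borel_type X), compact (L : set X) &
    L `<=` A /\ (mu (A `\` L) < e%:E)%E.
Proof.
move=> mA e0; have [supA _] := regular_mu mA.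
have fA : mu A \is a fin_num by exact: fin_num_measure.
have := fA; rewrite {1}supA => /(ub_ereal_sup_adherent e0).
rewrite -supA => -[_ [L [cL LA] <-] muL]; exists L => //; split => //.
have mL : measurable (L : set (borel_type X)) by exact: compact_borel.
have fL : mu L \is a fin_num by exact: fin_num_measure.
have {}muL : (mu A - e%:E < mu L)%E by exact: muL.
have -> : mu (A `\` L) = (mu A - mu L)%E.
  by rewrite measureD// ?setIidr// -ge0_fin_numE.
move: muL; rewrite -(fineK fA) -(fineK fL) !lte_fin.
by move: (fine _) (fine _) => a b; lra.
Qed.

(** Covers of [H] by sets of measure below [1/(n+1)], for all [n], are listed as one sequence [G].
    Compact sets [P m] inside and [Q m] outside [G m] nearly fill [H]. On the intersection [D] of
    their unions, Urysohn functions take only the values 0 and 1 and record membership in each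
    [G m]; [g] codes them into one number, which confines its fibres to sets of arbitrarily small
    measure. *)
Lemma compact_atomless_map (H : set (borel_type X)) : measurable H ->
    ~ mu.-negligible H -> nowhere_countably_generated mu H ->
  exists K : set X, exists g : X -> unit_itv R,
    [/\ compact K, K `<=` H, ~ mu.-negligible (K : set (borel_type X)) &
      continuous g] /\
    forall z, mu.-negligible (K `&` g @^-1` [set z] : set (borel_type X)).
Proof.
move=> mH H0 nH.
have /choice[E EP] n := nowhere_countably_generated_cover mH nH
  (ltac:(by []) : 0 < n.+1%:R^-1 :> R).
pose nk m := odflt (0, 0)%N (unpickle m : option (nat * nat)).
pose G m := E (nk m).1 (nk m).2.
have mG m : measurable (G m) by have [+ _ _] := EP (nk m).1; exact.
(* Stage [m] will lose at most [c / 2 ^ m.+1], so that at most half of the measure of [H] is lost in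
   total. *)
pose c : R := fine (mu H) / 2.
have fH : mu H \is a fin_num by exact: fin_num_measure.
have H_gt0 : (0 < fine (mu H)).
  rewrite -lte_fin fineK// lt_neqAle measure_ge0 andbT.
  by apply/eqP => /esym muH; apply: H0; apply/negligibleP.
have c0 : 0 < c by rewrite divr_gt0.
have pos m : 0 < c / (2 ^ m.+1)%:R / 2.
  by rewrite !divr_gt0// ltr0n expn_gt0.
have /choice[P PP] m : exists L : set X, compact L /\ L `<=` H `&` G m /\
    (mu ((H `&` G m) `\` L) < (c / (2 ^ m.+1)%:R / 2)%:E)%E.
  have [|L cL [? ?]] := @regular_measure_inner (H `&` G m) _ _ (pos m).
    exact: measurableI.
  by exists L.
have /choice[Q QP] m : exists L : set X, compact L /\ L `<=` H `\` G m /\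
    (mu ((H `\` G m) `\` L) < (c / (2 ^ m.+1)%:R / 2)%:E)%E.
  have [|L cL [? ?]] := @regular_measure_inner (H `\` G m) _ _ (pos m).
    exact: measurableD.
  by exists L.
have clP m : closed (P m) by apply: compact_closed => //; have [] := PP m.
have clQ m : closed (Q m) by apply: compact_closed => //; have [] := QP m.
have PQ0 m : P m `&` Q m = set0.
  apply/seteqP; split => // x [Px Qx].
  by have [_ [/(_ _ Px)[_ Gx] _]] := PP m; have [_ [/(_ _ Qx)[_]]] := QP m.
have normalX : normal_space X by exact: compact_normal.
have /choice[h hP] m := @urysohn_ext_itv X R normalX _ _ 0 1 (clP m) (clQ m)
  (PQ0 m) ltr01.
have ch m : continuous (h m) by have [] := hP m.
have h01 m x : 0 <= h m x <= 1.
  have [_ _ _ /(_ (h m x))] := hP m; rewrite /= in_itv /=; apply.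
  by exists x.
have hP0 m x : P m x -> h m x = 0.
  by move=> Px; have [_ /(_ (h m x)) + _ _] := hP m; apply; exists x.
have hQ1 m x : Q m x -> h m x = 1.
  by move=> Qx; have [_ _ /(_ (h m x)) + _] := hP m; apply; exists x.
have [g [cg g01 g_inj]] := ternary_code ch h01.
pose D := \bigcap_m (P m `|` Q m).
have clD : closed D by apply: closed_bigI => m _; exact: closedU.
have mD : measurable (D : set (borel_type X)) by exact: closed_borel.
have DH : D `<=` H.
  move=> x /(_ 0%N I)[]; first by have [_ [+ _]] := PP 0%N => /[apply] -[].
  by have [_ [+ _]] := QP 0%N => /[apply] -[].
have hD x m : D x -> h m x = 0 \/ h m x = 1.
  by move=> /(_ m I)[/hP0|/hQ1]; [left|right].
exists D, (fun x => exist (fun y : R => 0 <= y <= 1) (g x) (g01 x)); split.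
  split => //.
  - exact: (subclosed_compact clD compactX).
  - move=> /(negligibleP _ mD) D0.
    have mPQ m : measurable (H `\` (P m `|` Q m) : set (borel_type X)).
      by apply: measurableD => //; apply: measurableU; exact: closed_borel.
    have : (mu H <= c%:E)%E.
      rewrite (measureDI mu mH mD) setIidr// D0 adde0.
      apply: (@le_trans _ _ (\sum_(m <oo) (c / (2 ^ m.+1)%:R)%:E)%E); last first.
        exact/epsilon_trick0/ltW.
      apply: (@le_trans _ _ (\sum_(m <oo) mu (H `\` (P m `|` Q m)))%E).
        apply: measure_sigma_subadditive => //; first exact: measurableD.
        by rewrite /D setDE setC_bigcap setI_bigcupr.
      apply: lee_nneseries => [//|m _]; rewrite [in leRHS](splitr (c / _)) EFinD.
      have mHG : measurable ((H `&` G m) `\` P m : set (borel_type X)).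
        by apply: measurableD; [exact: measurableI|exact: closed_borel].
      have mHG' : measurable ((H `\` G m) `\` Q m : set (borel_type X)).
        by apply: measurableD; [exact: measurableD|exact: closed_borel].
      have [[_ [_ /ltW muP]] [_ [_ /ltW muQ]]] := (PP m, QP m).
      apply: le_trans (leeD muP muQ); apply: le_trans (measureU2 _ mHG mHG').
      apply: le_measure; rewrite ?inE//; first exact: measurableU.
      move=> x [Hx /not_orP[nPx nQx]].
      by have [?|?] := pselect (G m x); [left|right].
    by rewrite -(fineK fH) lee_fin /c; lra.
  - exact: continuous_unit_itv.
(* [W] collects the points of [H] that some cover misses. If the fibre meets [D] only in [W], it is
   null; otherwise it contains a point [x0] that every cover reaches. *)
move=> z; pose W := \bigcup_n (H `\` \bigcup_k E n k).
have W0 : mu.-negligible W by apply: negligible_bigcup => n; have [] := EP n.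
have [[x0 [[Dx0 gx0] nWx0]]|none] := pselect (exists x,
    (D `&` [set x | exist (fun y : R => 0 <= y <= 1) (g x) (g01 x) = z]) x /\
    ~ W x); last first.
  apply: negligibleS W0 => x Dx; apply: contrapT => nWx; apply: none.
  by exists x.
apply: (@negligibleS _ _ _ mu (D `&` g @^-1` [set g x0])).
  by move=> x [Dx gx]; split => //; have [] := etrans gx (esym gx0).
have mDg : measurable (D `&` g @^-1` [set g x0] : set (borel_type X)).
  apply: closed_borel; apply: closedI => //.
  by apply: closed_comp; [move=> x _; exact: cg|exact: closed_eq].
apply/negligibleP => //; apply/eqP; rewrite eq_le measure_ge0 andbT.
apply/lee_addgt0Pr => r r0; rewrite add0e.
have [n ne] := ltr_add_invr r0; rewrite add0r in ne.
have [k Ek] : exists k, E n k x0.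
  apply: contrapT => nEx0; apply: nWx0; exists n => //; split; first exact: DH.
  by move=> [k _ Ek]; apply: nEx0; exists k.
(* Every point of [D] in the fibre of [x0] shares the digit 0 of [x0] at the index [m] of [E n k],
   hence lies in [P m], a subset of [E n k]. *)
pose m := pickle (n, k).
have Gm : G m = E n k by rewrite /G /nk /m pickleK.
have hx0 : h m x0 = 0.
  have [/hP0//|Qx] := Dx0 m I.
  by have [_ [/(_ _ Qx)[_]]] := QP m; rewrite Gm.
have [mE muE _] := EP n.
apply: (@le_trans _ _ (mu (E n k))); last first.
  by apply: ltW; apply: lt_trans (muE k) _; rewrite lte_fin.
apply: le_measure; rewrite ?inE// => x [Dx gx].
have := g_inj x x0 (hD x ^~ Dx) (hD x0 ^~ Dx0) gx m; rewrite hx0 => hx.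
have [Px|/hQ1] := Dx m I; last by rewrite hx => /eqP; rewrite eq_sym oner_eq0.
by have [_ [/(_ _ Px)[_]]] := PP m; rewrite Gm.
Qed.

End radon.

(** * The tree of compact sets *)

(** On the domain, [P n] and [Q n] are complementary relatively closed sets, so each coordinate is
    locally constant. *)
Lemma continuous_cantor_code (X : topologicalType) (P Q : nat -> set X) :
    (forall n, closed (P n)) -> (forall n, closed (Q n)) ->
    (forall n, P n `&` Q n = set0) ->
  {within \bigcap_n (P n `|` Q n),
    continuous ((fun x n => `[< P n x >]) : X -> cantor_space)}.
Proof.
move=> clP clQ PQ; apply/subspace_continuousP => x Dx.
apply/cvg_sup => n U [V] [[W] oW <-] Wx WU.
have same : \forall y \near x, (\bigcap_n (P n `|` Q n)) y ->
    `[< P n y >] = `[< P n x >].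
  have [Px|nPx] := pselect (P n x).
    have nQx : ~ Q n x by move=> Qx; have : set0 x by rewrite -(PQ n).
    have : nbhs x (~` Q n).
      by apply: open_nbhs_nbhs; split => //; exact: closed_openC.
    apply: filterS => y nQy Dy; have [Py|//] := Dy n I.
    by rewrite !asboolT.
  have : nbhs x (~` P n).
    by apply: open_nbhs_nbhs; split => //; exact: closed_openC.
  by apply: filterS => y nPy _; rewrite !asboolF.
rewrite /= /nbhs /= /within /=; apply: filterS same => y eq_y Dy.
apply: WU; change (W `[< P n y >]); rewrite (eq_y Dy); exact: Wx.
Qed.

Section loose.
Context (R : realType) (X : ptopologicalType) (Y : topologicalType).
Hypothesis hausdorffX : hausdorff_space X.
Variable mu : {finite_measure set (borel_type X) -> \bar R}.
Hypothesis regular_mu : regular_measure mu.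
Hypothesis hausdorffY : hausdorff_space Y.
Hypothesis secondY : @second_countable Y.
Variable f : X -> Y.
Hypothesis cf : continuous f.
Variable K : set X.
Hypothesis compactK : compact K.
Hypothesis nK : nowhere_countably_generated mu (K : set (borel_type X)).
Hypothesis K_non_negligible : ~ mu.-negligible (K : set (borel_type X)).
Hypothesis fibers : forall y,
  mu.-negligible (K `&` f @^-1` [set y] : set (borel_type X)).

Lemma preimage_basis_sigma_algebra (B : set (set Y)) : countable B -> basis B ->
  forall U, open U -> <<s (fun V => f @^-1` V) @` B >> (f @^-1` U).
Proof.
move=> cB [Bo Bx] U oU.
have -> : f @^-1` U = \bigcup_(V in B `&` [set V | V `<=` U]) (f @^-1` V).
  apply/seteqP; split => [x Ux|x [V [_ VU] Vx]]; last exact: VU.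
  have [V [BV Vx] VU] := Bx (f x) U (open_nbhs_nbhs (conj oU Ux)).
  by exists V.
apply: sigma_algebra_countable_bigcup.
  by apply: sub_countable cB; apply: subset_card_le => V [].
by move=> V [BV _]; apply: sub_sigma_algebra; exists V.
Qed.

(** A node of the tree pairs a compact set with a base over which it is full. [D] consists of the
    points lying in some compact set of every level, and the loose function reads off the branch
    that such a point follows. *)
Lemma exists_strongly_c_loose : exists D phi, strongly_c_loose f D phi.
Proof.
have [B cB basisB] := secondY; have [Bo _] := basisB.
pose F : set (set (borel_type X)) := (fun V => f @^-1` V) @` B.
have cF : countable F by apply: sub_countable cB; exact: card_image_le.
have mF : F `<=` measurable.
  move=> _ [V BV <-]; apply: sub_sigma_algebra; apply: open_comp.
    by move=> x _; exact: cf.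
  exact: Bo.
have sFm := sigma_sub_measurable mF.
have sF_closed C : closed C -> <<s F >> (f @^-1` C).
  move=> clC; rewrite -[C]setCK preimage_setC.
  apply: (@measurableC _ (g_sigma_algebraType F)).
  exact: (preimage_basis_sigma_algebra cB basisB (closed_openC clC)).
pose valid (p : set (borel_type X) * set (borel_type X)) :=
  [/\ compact (p.1 : set X), p.1 `<=` K, <<s F >> p.2 & full_over mu F p.1 p.2].
(* From a node [(L, C)] and [e], [step] returns two disjoint compact subsets of [L] with a common
   base inside [C], smaller than [C] by less than [e]. On invalid input its value is junk. *)
have /choice[step stepP]
    (pe : (set (borel_type X) * set (borel_type X)) * R) :
    exists r : set (borel_type X) * set (borel_type X) * set (borel_type X),
    valid pe.1 -> 0 < pe.2 ->
    [/\ valid (r.1.1, r.2), valid (r.1.2, r.2), r.1.1 `<=` pe.1.1 &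
        r.1.2 `<=` pe.1.1] /\
    [/\ r.1.1 `&` r.1.2 = set0, r.2 `<=` pe.1.2 &
        (mu (pe.1.2 `\` r.2) < pe.2%:E)%E].
  case: pe => -[L C] e /=.
  have [[cL LK sC LC]|nv] := pselect (valid (L, C)); last by exists (L, C, C).
  have [e0|e0] := ltP 0 e; last by exists (L, C, C).
  have mL : measurable L by exact: compact_borel.
  have nL := nowhere_countably_generatedS LK nK.
  have [A0 [A1 [[mA0 mA1 A0L A1L] [A01 A0C A1C]]]] :=
    full_over_split cF mF mL nL sC LC.
  have e2 : 0 < e / 2 by rewrite divr_gt0.
  pose KK : set (set (borel_type X)) := [set L | compact (L : set X)].
  have KK0 : KK set0 by exact: compact0.
  have KKU : setU_closed KK by exact: compactU.
  have KKm : KK `<=` measurable by move=> ?; exact: compact_borel.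
  have KKinner := regular_measure_inner hausdorffX regular_mu.
  have [L0 [B0 [[cL0 L0A sB0 B0C] [L0B0 muB0]]]] :=
    full_over_inner mF KK0 KKU KKm KKinner mA0 sC A0C e2.
  have [L1 [B1 [[cL1 L1A sB1 B1C] [L1B1 muB1]]]] :=
    full_over_inner mF KK0 KKU KKm KKinner mA1 sC A1C e2.
  have sB01 : <<s F >> (B0 `&` B1).
    exact: (@measurableI _ (g_sigma_algebraType F)).
  exists (L0, L1, B0 `&` B1) => _ _ /=; split; split.
  - split => //=; first by apply: subset_trans L0A _; exact: subset_trans LK.
    by apply: full_overS L0B0 => // x [].
  - split => //=; first by apply: subset_trans L1A _; exact: subset_trans LK.
    by apply: full_overS L1B1 => // x [].
  - exact: subset_trans A0L.
  - exact: subset_trans A1L.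
  - by apply/seteqP; split => // x [/L0A ? /L1A ?]; rewrite -A01.
  - by move=> x [/B0C].
  - rewrite [e]splitr EFinD setDIr.
    have mCB0 : measurable (C `\` B0) by apply: measurableD; exact: sFm.
    have mCB1 : measurable (C `\` B1) by apply: measurableD; exact: sFm.
    by apply: le_lt_trans (measureU2 _ mCB0 mCB1) _; exact: lteD.
(* The base of the root is the complement of [N]; it is non-null because, up to a null set, it
   contains [K]. *)
have [N [sN KN fullK]] := full_over_setC mu mF (K : set (borel_type X)).
pose B0 := ~` N : set (borel_type X).
have sB0 : <<s F >> B0 by exact: (@measurableC _ (g_sigma_algebraType F)).
have mB0 := sFm _ sB0.
have fB0 : mu B0 \is a fin_num by exact: fin_num_measure.
have B0_gt0 : 0 < fine (mu B0).
  rewrite -lte_fin fineK// lt_neqAle measure_ge0 andbT.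
  apply/eqP => /esym/(negligibleP _ mB0) B00; apply: K_non_negligible.
  apply: (@negligibleS _ _ _ mu ((K `&` N) `|` B0)); last exact: negligibleU.
  by move=> x Kx; have [?|?] := pselect (N x); [left|right].
pose c := fine (mu B0) / 2.
have c0 : 0 < c by rewrite divr_gt0.
(* Weighting nodes by their codes bounds the total loss over the whole tree by [c], half the measure
   of [B0]. *)
pose eps (s : seq bool) : R := c / (2 ^ (pickle s).+1)%:R.
have eps0 s : 0 < eps s by rewrite divr_gt0// ltr0n expn_gt0.
(* The head of the list is the latest choice, so consing a bit descends to a child. *)
pose node := fix node (s : seq bool) :=
  if s is b :: s' then
    let r := step (node s', eps s') in (if b then r.1.1 else r.1.2, r.2)
  else (K : set (borel_type X), B0).
have nodeP s : valid (node s).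
  elim: s => [|b s ih]; first by split.
  by have [[v1 v2 _ _] _] := stepP (node s, eps s) ih (eps0 s); case: b.
have node_sub1 b s : (node (b :: s)).1 `<=` (node s).1.
  by have [[_ _ s1 s2] _] := stepP (node s, eps s) (nodeP s) (eps0 s); case: b.
have node_sub2 b s : (node (b :: s)).2 `<=` (node s).2.
  by have [_ [_ + _]] := stepP (node s, eps s) (nodeP s) (eps0 s).
have node_mu s : (mu ((node s).2 `\` (step (node s, eps s)).2) < (eps s)%:E)%E.
  by have [_ [_ _ +]] := stepP (node s, eps s) (nodeP s) (eps0 s).
have node_disj s t x : size s = size t -> (node s).1 x -> (node t).1 x -> s = t.
  elim: s t => [|b s ih] [|b' t] //= [st] xs xt.
  have stE : s = t.
    by apply: ih => //; [exact: (node_sub1 b)|exact: (node_sub1 b')].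
  rewrite stE; congr (_ :: _); move: xs xt; rewrite stE => xs xt.
  have [_ [+ _ _]] := stepP (node t, eps t) (nodeP t) (eps0 t).
  by move=> /seteqP[/(_ x) dis _]; case: b b' xs xt => -[] //= ? ?; exfalso;
    apply: dis; split.
have cl1 s : closed ((node s).1 : set X).
  by apply: compact_closed => //; have [] := nodeP s.
(* The points of level [n.+1] whose choice number [n], counted from 0, is [b]. *)
pose U b n : set X := \bigcup_(t in [set: n.-tuple bool]) (node (b :: t)).1.
have clU b n : closed (U b n).
  by apply: closed_bigcup => [|t _]; [exact: finite_finset|exact: cl1].
have U0 n : U true n `&` U false n = set0.
  apply/seteqP; split => // x [[s _ xs] [t _ xt]].
  have := node_disj (true :: s) (false :: t) x.
  by rewrite /= !size_tuple => /(_ erefl xs xt).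
pose D := \bigcap_n (U true n `|` U false n).
exists D, (fun x n => `[< U true n x >]); split.
- by apply: closed_bigI => n _; exact: closedU.
- by apply: (@continuous_cantor_code X (U true) (U false)).
pose Q := \bigcap_s (f @` (node s).1).
exists Q.
  apply: uncountable_not_scattered => // cQ.
  (* The intersection of all bases; indices that code no node contribute [B0], the base of the
     root. *)
  pose P := \bigcap_n oapp (fun s => (node s).2) B0 (unpickle n).
  have sP : <<s F >> P.
    apply: (@bigcap_measurable _ (g_sigma_algebraType F)); first by exists 0%N.
    move=> n _; case: (unpickle n) => //= s; have [_ _ + _] := nodeP s; exact.
  have Pnode s : P `<=` (node s).2.
    move=> x /(_ (pickle s) I); rewrite (_ : unpickle (pickle s) = Some s)//.
    exact: pickleK.
  have PB0 : P `<=` B0 by exact: (Pnode [::]).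
  have mP := sFm _ sP.
  (* By fullness of [K] it suffices to bound the part of [P] in [K]. Points mapped into the
     countable [Q] lie in countably many null fibres. Any other point lies, for some [s], in the
     base of [s] but outside the preimage of the image of its compact set; this set is null by
     fullness, since it avoids that compact set. *)
  have P0 : mu.-negligible P.
    apply: fullK => //.
    apply: (@negligibleS _ _ _ mu ((\bigcup_(y in Q) (K `&` f @^-1` [set y])) `|`
      \bigcup_(s in [set: seq bool]) ((node s).2 `\` f @^-1` (f @` (node s).1)))).
      move=> x [Kx Px]; have [Qx|] := pselect (Q (f x)); first by left; exists (f x).
      move=> /existsNP[s /not_implyP[_ nfx]]; right; exists s => //; split => //.
      exact: Pnode.
    apply: negligibleU; first exact: negligible_countable_bigcup.
    apply: negligible_countable_bigcup => // s _.
    have [cs _ sB2 fulls] := nodeP s; apply: fulls.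
    - apply: (@measurableD _ (g_sigma_algebraType F)) => //; apply: sF_closed.
      apply: compact_closed => //; apply: continuous_compact => //.
      exact: continuous_subspaceT.
    - by move=> x [].
    - rewrite [X in mu.-negligible X](_ : _ = set0); first exact: negligible_set0.
      by apply/seteqP; split => // x [xs [_ nfx]]; apply: nfx; exists x.
  have : (mu B0 <= c%:E)%E.
    rewrite (measureDI mu mB0 mP) setIidr//.
    move/(negligibleP _ mP) : P0 => ->; rewrite adde0.
    (* The losses indexed by codes: [pickle_inv] is defined only on actual codes, so each node is
       counted once, with its own weight. *)
    pose G n := oapp (fun s => (node s).2 `\` (step (node s, eps s)).2) set0
      (pickle_inv n : option (seq bool)).
    have sG s : measurable ((node s).2 `\` (step (node s, eps s)).2).
      have [_ _ ? _] := nodeP s; have [_ _ ? _] := nodeP (true :: s).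
      by apply: measurableD; exact: sFm.
    have mG n : measurable (G n) 
      by rewrite /G; case: (pickle_inv n) => [s|] /=; [exact: sG|exact: measurable0].
    apply: (@le_trans _ _ (\sum_(n <oo) mu (G n))%E).
      apply: measure_sigma_subadditive => //; first exact: measurableD.
      move=> x [B0x nPx].
      (* A point outside [P] has left some base; going back towards the root finds the node at which
         it was lost. *)
      have [s nBx] : exists s, ~ (node s).2 x.
        apply: contrapT => /forallNP nBx; apply: nPx => n _.
        by case: (unpickle n) => //= s; apply: contrapT; exact: nBx.
      elim: s nBx => [//|b s ih] nBx.
      have [Bx|/ih//] := pselect ((node s).2 x).
      by exists (pickle s) => //; rewrite /G pickleK_inv.
    apply: (@le_trans _ _ (\sum_(n <oo) (c / (2 ^ n.+1)%:R)%:E)%E); last first.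
      exact/epsilon_trick0/ltW.
    apply: lee_nneseries => [//|n _]; rewrite /G.
    have := @pickle_invK (seq bool) n; case: (pickle_inv n) => [s /= <-|_] /=.
      exact/ltW/node_mu.
    by rewrite measure0 lee_fin divr_ge0// ltW.
  by rewrite -(fineK fB0) lee_fin /c; lra.
move=> y Qy; apply/seteqP; split => // sigma _.
(* [pre n] is the branch [sigma] cut at level [n], latest choice first. Its compact sets all meet
   the fibre of [y] because [y] is in [Q], so by compactness one point of the fibre follows the
   entire branch. *)
pose pre := fix pre n := if n is n'.+1 then sigma n' :: pre n' else [::].
have size_pre n : size (pre n) = n by elim: n => //= n ->.
have [||||x xP] := @compact_nested X (fun n => (node (pre n)).1 `&` f @^-1` [set y]).
- by move=> n x [xs fx]; split => //; exact: (node_sub1 (sigma n)).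
- move=> n; apply: closedI => //; apply: closed_comp => [x _|]; first exact: cf.
  exact/accessible_closed_set1/hausdorff_accessible.
- apply: compact_closedI => //; apply: closed_comp => [x _|]; first exact: cf.
  exact/accessible_closed_set1/hausdorff_accessible.
- by move=> n; have [x xs fx] := Qy (pre n) I; exists x.
have xU n : U (sigma n) n x.
  have sz : size (pre n) == n by rewrite size_pre.
  by exists (Tuple sz) => //; have [] := xP n.+1.
exists x.
  split; first by have [] := xP 0%N.
  by move=> n _; have := xU n; case: (sigma n); [left|right].
apply/funext => n; have := xU n; case: (sigma n) => xUn; first exact/asboolT.
by apply/asboolF => xUt; have : set0 x by rewrite -(U0 n).
Qed.

End loose.

(** * Separability of [L^1] *)

Section Lspace1.
Context (d : measure_display) (T : measurableType d) (R : realType).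
Variable mu : {measure set T -> \bar R}.

Variable one_le1 : (1 <= 1%:E :> \bar R)%E.

Lemma Lspace1_measurable (f : LspaceType mu one_le1) :
  measurable_fun [set: T] (f : T -> R).
Proof.
exact: (measurable_funPT (repr (f : {mfun_ mu, T >-> measurableTypeR R}))).
Qed.

Lemma Lspace1_fin (f : LspaceType mu one_le1) :
  ('N[mu]_1[EFin \o (f : T -> R)] < +oo)%E.
Proof. exact: (@Lebesgue_finite _ _ _ _ _ _ f). Qed.

(** Serves to turn the explicit step functions of the dense family into elements of the quotient
    space. *)
Lemma Lspace1_class (h : T -> R) : measurable_fun [set: T] h ->
    ('N[mu]_1[EFin \o h] < +oo)%E ->
  exists g : LspaceType mu one_le1,
    'N[mu]_1[EFin \o ((g : T -> R) \- h)%R]%E = 0%E.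
Proof.
move=> mh finh.
pose hm : {mfun T >-> measurableTypeR R} :=
  HB.pack (h : T -> measurableTypeR R) 
    (isMeasurableFun.Build _ _ T (measurableTypeR R) h mh).
pose q : {mfun_ mu, T >-> measurableTypeR R} := (\pi hm)%qT.
have qh : {ae mu, forall x, repr q x = h x}.
  have /eqmodP/asboolP : repr q = hm %[mod {mfun_ mu, T >-> measurableTypeR R}]%qT.
    by rewrite reprK.
  by apply: filterS => x /(_ I).
have mq : measurable_fun [set: T] (repr q : T -> R).
  exact: (measurable_funPT (repr q)).
have mabs (k : T -> R) : measurable_fun [set: T] k ->
    measurable_fun [set: T] (fun x => `|(EFin \o k) x|)%E.
  by move=> mk; apply: measurableT_comp => //; exact/measurable_EFinP.
have finq : finite_norm mu 1%:E q.
  rewrite /finite_norm Lnorm1; move: finh; rewrite Lnorm1; congr (_ < _)%E.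
  apply: ge0_ae_eq_integral => //.
  - exact: (mabs _ mh).
  - exact: (mabs _ mq).
  - by apply: filterS qh => x qhx _ /=; rewrite -qhx.
pose g : LspaceType mu one_le1 := HB.pack q
  (isFinLebesgue.Build _ _ _ mu 1%:E one_le1 q finq).
exists g; rewrite Lnorm1; apply/ae_eq_integral_abs => //.
  by apply/measurable_EFinP; exact: measurable_funB.
by apply: filterS qh => x qhx _ /=; rewrite /aqEqMfun_to_fun qhx subrr.
Qed.

End Lspace1.

(** Complements and binary unions are added in countably many rounds, each of which preserves
    countability and stays in the generated sigma-algebra. *)
Lemma countable_algebra (T : Type) (F : set (set T)) : countable F ->
  exists A : set (set T),
    [/\ countable A, F `<=` A, A set0 & A `<=` <<s F >>] /\
    setC_closed A /\ setU_closed A.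
Proof.
move=> cF.
pose step (A : set (set T)) := A `|` (setC @` A) `|`
  ((fun p => p.1 `|` p.2) @` (A `*` A)).
pose alg n := iter n step (set0 |` F).
have sub n : alg n `<=` alg n.+1 by move=> a Aa; left; left.
have mono m n : (m <= n)%N -> alg m `<=` alg n.
  elim: n => [|n ih]; first by rewrite leqn0 => /eqP ->.
  rewrite leq_eqVlt => /predU1P[->//|mn].
  by apply: subset_trans (ih mn) _; exact: sub.
exists (\bigcup_n alg n); split; [split|split].
- apply: bigcup_countable => // n _.
  elim: n => [|n ih]; first exact: countable_setU (countable1 _) cF.
  apply: countable_setU; first apply: countable_setU => //.
    by apply: sub_countable ih; exact: card_image_le.
  by apply: sub_countable (countableX ih ih); exact: card_image_le.
- by move=> a Fa; exists 0%N => //; right.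
- by exists 0%N => //; left.
- apply: bigcup_sub => n _; elim: n => [|n ih].
    by move=> a [->|Fa]; [exact: sigma_algebra0|exact: sub_sigma_algebra].
  move=> a [[/ih//|[b /ih sb <-]]|[[b c] [/= /ih sb /ih sc] <-]].
    by rewrite -setTD; exact: sigma_algebraCD.
  rewrite -bigcup2E; apply: sigma_algebra_bigcup => -[|[|i]] //=.
  exact: sigma_algebra0.
- by move=> a [n _ Aa]; exists n.+1 => //; left; right; exists a.
- move=> a b [n _ Aa] [m _ Ab]; exists (maxn n m).+1 => //; right.
  exists (a, b) => //; split => /=.
    exact: (mono _ _ (leq_maxl n m)).
  exact: (mono _ _ (leq_maxr n m)).
Qed.

Section approximation.
Context (d : measure_display) (T : measurableType d) (R : realType).
Variable mu : {finite_measure set T -> \bar R}.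

(** For a countable union, a finite part already leaves a tail of measure below [e / 2]; the
    approximation errors of the members share the other half geometrically. *)
Lemma sigma_algebra_approximable (A : set (set T)) :
    A `<=` measurable -> A set0 -> setC_closed A -> setU_closed A ->
  sigma_algebra [set: T] [set E | measurable E /\ forall e : R, 0 < e ->
    exists2 a, A a & (mu (E `+` a) < e%:E)%E].
Proof.
move=> mA A0 AC AU; split.
- split => // e e0; exists set0 => //.
  by rewrite setY0 measure0 lte_fin.
- move=> E [mE Eapp]; rewrite setTD; split; first exact: measurableC.
  move=> e /Eapp[a Aa muE]; exists (~` a); first exact: AC.
  suff -> : ~` E `+` ~` a = E `+` a by [].
  by apply/seteqP; split => x /=; have := pselect (E x); have := pselect (a x);
    tauto.
- move=> E EP; have mE n : measurable (E n) by have [] := EP n.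
  have mU : measurable (\bigcup_n E n) by exact: bigcupT_measurable.
  split => // e e0; have e2 : 0 < e / 2 by rewrite divr_gt0.
  pose P n := \bigcup_i E i `\` \bigcup_(i in `I_n) E i.
  have mP n : measurable (P n).
    by apply: measurableD => //; exact: bigcup_measurable.
  have [N muP] : exists N, (mu (P N) < (e / 2)%:E)%E.
    have P0 : \bigcap_n P n = set0.
      apply/seteqP; split => // x Px; have [[i _ Ex] _] := Px 0%N I.
      by have [_] := Px i.+1 I; apply; exists i => /=.
    have : mu (P n) @[n --> \oo] --> mu (\bigcap_n P n).
      apply: (@nonincreasing_cvg_mu _ _ _ mu P) => //.
      - by rewrite -ge0_fin_numE// fin_num_measure.
      - by rewrite P0.
      - move=> m n mn; apply/subsetPset => x [Ux nx]; split => //.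
        by apply: contra_not nx => -[i /= im Ex]; exists i => //=;
          exact: leq_trans im mn.
    rewrite P0 measure0.
    move=> /fine_cvgP[_ /cvgrPdist_lt/(_ _ e2)[n _ /(_ n (leqnn n))]].
    rewrite sub0r normrN => h; exists n.
    rewrite -(@fineK _ (mu (P n))) ?fin_num_measure//.
    by rewrite lte_fin; exact: le_lt_trans (ler_norm _) h.
  have /choice[a aP] i : exists a, A a /\
      (mu (E i `+` a) < (e / 2 / (2 ^ i.+1)%:R)%:E)%E.
    have [_ /(_ (e / 2 / (2 ^ i.+1)%:R))[|b Ab mub]] := EP i; last by exists b.
    by rewrite divr_gt0// ltr0n expn_gt0.
  have ma i : measurable (a i) by apply: mA; have [] := aP i.
  have mEa i : measurable (E i `+` a i).
    by apply: measurableU; exact: measurableD.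
  have AN : A (\big[setU/set0]_(i < N) a i).
    by apply: big_ind => // i _; have [] := aP i.
  exists (\big[setU/set0]_(i < N) a i) => //.
  have mUEa : measurable (\bigcup_i (E i `+` a i)) by exact: bigcupT_measurable.
  apply: (@le_lt_trans _ _ (mu (P N `|` \bigcup_i (E i `+` a i)))).
    apply: le_measure; rewrite ?inE.
    - by apply: measurableU; apply: measurableD => //; exact: mA.
    - exact: measurableU.
    - rewrite -bigcup_mkord => x [[[i _ Ex] nx]|[[i iN ax] nx]].
        have [[j jN Ejx]|nEx] := pselect ((\bigcup_(i in `I_N) E i) x).
          right; exists j => //; left; split => //.
          by apply: contra_not nx => ax; exists j.
        by left; split => //; exists i.
      right; exists i => //; right; split => //.
      by apply: contra_not nx => Ex; exists i.
  apply: le_lt_trans (measureU2 mu (mP N) mUEa) _.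
  rewrite [ltRHS](_ : _ = (e / 2)%:E + (e / 2)%:E)%E; last first.
    by rewrite -EFinD -splitr.
  apply: (@le_lt_trans _ _ (mu (P N) + (e / 2)%:E)%E); last by rewrite lteD2rE.
  apply: leeD2l; apply: (@le_trans _ _ (\sum_(i <oo) mu (E i `+` a i))%E).
    exact: measure_sigma_subadditive.
  apply: (@le_trans _ _ (\sum_(i <oo) (e / 2 / (2 ^ i.+1)%:R)%:E)%E).
    by apply: lee_nneseries => [//|i _]; apply: ltW; exact: (aP i).2.
  exact/epsilon_trick0/ltW.
Qed.

(** The sets approximable by the countable algebra form a sigma-algebra containing [F], hence
    contain each [B] that agrees with a given [E] up to a null set. *)
Lemma ess_countably_generated_approximable :
    ess_countably_generated mu [set: T] ->
  exists a : nat -> set T, (forall n, measurable (a n)) /\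
    forall (E : set T) (e : R), measurable E -> 0 < e ->
      exists n, (mu (E `+` a n) < e%:E)%E.
Proof.
move=> [F [cF mF FP]].
have [A [[cA FA A0 AsF] [AC AU]]] := countable_algebra cF.
have mA : A `<=` measurable.
  by apply: subset_trans AsF _; exact: sigma_sub_measurable.
have [|[a aE]] := countable_enum cA; first by move=> A_empty; rewrite A_empty in A0.
exists a; split; first by move=> n; apply: mA; rewrite aE; exists n.
move=> E e mE e0; have [//|B sB EB0] := FP E mE.
have : [set E | measurable E /\ forall e : R, 0 < e ->
    exists2 a, A a & (mu (E `+` a) < e%:E)%E] B.
  apply: (smallest_sub (sigma_algebra_approximable mA A0 AC AU)) sB => D FD.
  split; first exact: mF.
  move=> r r0; exists D; first exact: FA.
  by rewrite setYK measure0 lte_fin.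
move=> [mB /(_ e e0)[D]]; rewrite aE => -[n _ <-] muB; exists n.
have man : measurable (a n) by apply: mA; rewrite aE; exists n.
have mEB : measurable (E `+` B) by apply: measurableU; exact: measurableD.
have mBa : measurable (B `+` a n) by apply: measurableU; exact: measurableD.
apply: le_lt_trans muB.
rewrite -[leRHS](measureU0 mBa mEB); last exact/negligibleP.
apply: le_measure; rewrite ?inE.
- by apply: measurableU; exact: measurableD.
- exact: measurableU.
- by move=> x /=; have := pselect (E x); have := pselect (B x);
    have := pselect (a n x); tauto.
Qed.

End approximation.

Import HBSimple.

Section separability.
Context (d : measure_display) (T : measurableType d) (R : realType).
Variable mu : {finite_measure set T -> \bar R}.

Let dist1 (h k : T -> R) := 'N[mu]_1[EFin \o (h \- k)%R]%E.

Let dist1_triangle (k h l : T -> R) : measurable_fun [set: T] h ->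
  measurable_fun [set: T] k -> measurable_fun [set: T] l ->
  (dist1 h l <= dist1 h k + dist1 k l)%E.
Proof.
move=> mh mk ml; rewrite /dist1.
rewrite [leLHS](_ : _ = 'N[mu]_1[EFin \o ((h \- k) \+ (k \- l))%R]%E); last first.
  by congr ('N[mu]__[_]%E); apply/funext => x /=; rewrite addrA subrK.
by apply: eminkowski => //; exact: measurable_funB.
Qed.

Lemma Lnorm1_indic (c : R) (A : set T) : measurable A ->
  'N[mu]_1[EFin \o (fun x => c * \1_A x)%R]%E = (`|c|%:E * mu A)%E.
Proof.
move=> mA; rewrite Lnorm1.
rewrite (_ : (fun x => _) = (fun x => `|c|%:E * (\1_A x)%:E)%E); last first.
  by apply/funext => x /=; rewrite normrM -EFinM [X in _ * X]ger0_norm.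
rewrite ge0_integralZl//; last exact/measurable_EFinP/measurable_indic.
by rewrite integral_indic// setIT.
Qed.

Variable a : nat -> set T.
Hypothesis ma : forall n, measurable (a n).
Hypothesis approx_a : forall (E : set T) (e : R), measurable E -> 0 < e ->
  exists n, (mu (E `+` a n) < e%:E)%E.

(** Coding step functions by finite lists of rational coefficients and indices makes their family
    countable. *)
Let phi (s : seq (rat * nat)) (x : T) : R :=
  \sum_(p <- s) ratr p.1 * \1_(a p.2) x.

Let mphi s : measurable_fun [set: T] (phi s).
Proof.
elim: s => [|p s ih].
  rewrite (_ : phi _ = cst 0); first exact: measurable_cst.
  by apply/funext => x; rewrite /phi big_nil.
rewrite (_ : phi _ = (fun x => ratr p.1 * \1_(a p.2) x) \+ phi s); last first.
  by apply/funext => x; rewrite /phi big_cons.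
apply: measurable_funD => //; apply: measurable_funM; first exact: measurable_cst.
exact: measurable_indic.
Qed.

Let approximable (h : T -> R) := forall e : R, 0 < e ->
  exists s, (dist1 h (phi s) < e%:E)%E.

Let approximableD h k : measurable_fun [set: T] h -> measurable_fun [set: T] k ->
  approximable h -> approximable k -> approximable (h \+ k).
Proof.
move=> mh mk ah ak e e0; have e2 : 0 < e / 2 by rewrite divr_gt0.
have [s hs] := ah _ e2; have [t kt] := ak _ e2; exists (s ++ t).
rewrite /dist1 (_ : _ \- _ = (h \- phi s) \+ (k \- phi t)); last first.
  by apply/funext => x; rewrite /phi /= big_cat /=; ring.
apply: le_lt_trans (eminkowski _ _ _ _) _ => //; try exact: measurable_funB.
by rewrite [e]splitr EFinD; exact: lteD.
Qed.

(** Replacing [r] by a rational [q] costs [|r - q|] times the measure of [E]; replacing [E] by [a n]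
    costs [|q|] times the measure of the symmetric difference. The added 1 in [M] and [N] keeps the
    divisors positive. *)
Let approximable_indic (r : R) (E : set T) : measurable E ->
  approximable (fun x => r * \1_E x).
Proof.
move=> mE e e0; have e2 : 0 < e / 2 by rewrite divr_gt0.
have fE : mu E \is a fin_num by exact: fin_num_measure.
pose M := fine (mu E) + 1.
have M0 : 0 < M by rewrite /M ltr_wpDl// fine_ge0.
have [q rq] : exists q : rat, `|r - ratr q| < e / 2 / M.
  have [|q] := @rat_in_itvoo R (r - e / 2 / M) (r + e / 2 / M).
    by rewrite ltrBlDr -addrA ltrDl addr_gt0// divr_gt0.
  rewrite in_itv/= => /andP[q1 q2]; exists q.
  by rewrite ltr_norml; apply/andP; split; lra.
pose N : R := `|ratr q| + 1.
have N0 : 0 < N by rewrite /N ltr_wpDl.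
have [n mun] := approx_a mE (divr_gt0 e2 N0).
have mEa : measurable (E `+` a n) by apply: measurableU; exact: measurableD.
have mI c A : measurable A -> measurable_fun [set: T] (fun x => c * \1_A x : R).
  move=> mA; apply: measurable_funM; first exact: measurable_cst.
  exact: measurable_indic.
exists [:: (q, n)].
have -> : phi [:: (q, n)] = (fun x => ratr q * \1_(a n) x).
  by apply/funext => x; rewrite /phi big_seq1.
apply: (@le_lt_trans _ _ _ _ _
  (@dist1_triangle (fun x => ratr q * \1_E x) _ _ _ _ _)).
- exact: mI.
- exact: mI.
- exact: mI.
rewrite [e]splitr EFinD; apply: lteD.
  rewrite /dist1 (_ : _ \- _ = (fun x => (r - ratr q) * \1_E x)); last first.
    by apply/funext => x /=; rewrite mulrBl.
  rewrite Lnorm1_indic// -(fineK fE) -EFinM lte_fin.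
  apply: (@le_lt_trans _ _ (`|r - ratr q| * M)).
    by rewrite ler_wpM2l// /M lerDl.
  by rewrite -ltr_pdivlMr.
rewrite /dist1 Lnorm1.
have -> : (\int[mu]_x `|(EFin \o ((fun x => (ratr q * \1_E x)%R) \-
    (fun x => (ratr q * \1_(a n) x)%R))%R) x| =
    'N[mu]_1[EFin \o (fun x => ratr q * \1_(E `+` a n) x)%R])%E.
  rewrite Lnorm1; apply: eq_integral => x _ /=.
  rewrite -mulrBr !normrM; congr (_ * _)%:E; rewrite !indicE.
  have [Ex|nEx] := pselect (E x); have [ax|nax] := pselect (a n x).
  - by rewrite (mem_set Ex) (mem_set ax) memNset ?subrr//= => -[[]|[]].
  - by rewrite (mem_set Ex) (memNset nax) mem_set ?subr0//=; left.
  - by rewrite (memNset nEx) (mem_set ax) mem_set ?sub0r ?normrN//=; right.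
  - by rewrite (memNset nEx) (memNset nax) memNset ?subrr//= => -[[]|[]].
rewrite Lnorm1_indic//.
have fEa : mu (E `+` a n) \is a fin_num by exact: fin_num_measure.
move: mun; rewrite -(fineK fEa) -EFinM !lte_fin => mun.
apply: (@le_lt_trans _ _ (N * fine (mu (E `+` a n)))).
  by rewrite ler_wpM2r ?fine_ge0// /N lerDl.
by rewrite mulrC -ltr_pdivlMr.
Qed.

Let approximable_sfun (g : {sfun T >-> R}) : approximable g.
Proof.
have -> : (g : T -> R) = (fun x => \sum_(y <- finmap.enum_fset (fset_set (range g)))
    y * \1_(g @^-1` [set y]) x).
  by apply/funext => x; rewrite fimfunE fsbig_finite.
elim: (finmap.enum_fset _) => [|y s ih].
  move=> e e0; exists [::]; rewrite /dist1.
  rewrite (_ : _ \- _ = (fun x => 0 * \1_(@set0 T) x)); last first.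
    by apply/funext => x; rewrite /phi /= !big_nil subrr mul0r.
  by rewrite Lnorm1_indic// measure0 mule0 lte_fin.
have mg z : measurable (g @^-1` [set z]).
  by rewrite -[_ @^-1` _]setTI; exact: measurable_funP.
have mI z : measurable_fun [set: T] (fun x => z * \1_(g @^-1` [set z]) x : R).
  apply: measurable_funM; first exact: measurable_cst.
  exact: measurable_indic.
rewrite (_ : (fun x => _) = (fun x => y * \1_(g @^-1` [set y]) x) \+
  (fun x => \sum_(z <- s) z * \1_(g @^-1` [set z]) x)); last first.
  by apply/funext => x; rewrite big_cons.
apply: approximableD => //; last exact: approximable_indic.
exact: measurable_sum.
Qed.

(** The exponent is 1: an integrable function is near a simple one, which is near some [phi s],
    whose class [psi s] is at distance zero from it. *)
Lemma approximable_separable_measure : separable_measure mu.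
Proof.
have one_le1 : (1 <= 1%:E :> \bar R)%E by [].
exists 1, one_le1.
have finphi s : ('N[mu]_1[EFin \o phi s] < +oo)%E.
  elim: s => [|p s ih].
    rewrite (_ : phi _ = (fun x => 0 * \1_(@set0 T) x)); last first.
      by apply/funext => x; rewrite /phi big_nil mul0r.
    by rewrite Lnorm1_indic// measure0 mule0 ltry.
  rewrite (_ : phi _ = (fun x => ratr p.1 * \1_(a p.2) x) \+ phi s); last first.
    by apply/funext => x; rewrite /phi big_cons.
  apply: le_lt_trans (eminkowski _ _ _ _) _ => //.
    apply: measurable_funM; first exact: measurable_cst.
    exact: measurable_indic.
  rewrite lte_add_pinfty// Lnorm1_indic//.
  by rewrite -(@fineK _ (mu (a p.2))) ?fin_num_measure// -EFinM ltry.
have /choice[psi psiP] s := Lspace1_class one_le1 (mphi s) (finphi s).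
exists (range psi).
  by apply: sub_countable (card_image_le _ _) _; exact: countableP.
move=> f e e0.
have e2 : 0 < e / 2 by rewrite divr_gt0.
have mf := Lspace1_measurable f.
have intf : mu.-integrable [set: T] (EFin \o (f : T -> R)).
  apply/integrableP; split; first exact/measurable_EFinP.
  by have := Lspace1_fin f; rewrite Lnorm1.
have [g_ [_ _ g_f]] := approximation_sfun_integrable measurableT intf.
have [n gn] : exists n, (dist1 f (g_ n) < (e / 2)%:E)%E.
  move/fine_cvgP : g_f => [fin_g /cvgrPdist_lt/(_ _ e2) g_f].
  have [n _ /(_ n (leqnn n))[gn fgn]] := filterI fin_g g_f; exists n.
  rewrite /dist1 Lnorm1.
  have -> : (\int[mu]_x `|(EFin \o ((f : T -> R) \- g_ n)%R) x| =
      \int[mu]_x `|(EFin \o (f : T -> R)) x - (g_ n x)%:E|)%E by [].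
  rewrite -(fineK gn) lte_fin; move: fgn; rewrite sub0r normrN.
  exact: le_lt_trans (ler_norm _).
have mg : measurable_fun [set: T] (g_ n : T -> R) by exact: measurable_funPT.
have [s gs] := approximable_sfun (g_ n) e2.
exists (psi s); first by exists s.
have mpsi := Lspace1_measurable (psi s).
have psi0 : dist1 (phi s) (psi s) = 0%E.
  rewrite -[RHS](psiP s) /dist1 !Lnorm1; apply: eq_integral => x _ /=.
  by rewrite distrC.
apply: le_lt_trans (dist1_triangle mf mg mpsi) _.
rewrite [e]splitr EFinD; apply: lteD => //.
apply: le_lt_trans gs; rewrite -[leRHS]adde0 -psi0.
exact: dist1_triangle.
Qed.

End separability.

(** * Radon measures on weakly c-dissipated spaces *)

Theorem theorem5p8 (R : realType) (X : ptopologicalType)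
    (hausdorffX : hausdorff_space X)
    (dissipatedX : weakly_c_dissipated R X)
    (mu : {finite_measure set (borel_type X) -> \bar R})
    (regular_mu : regular_measure mu) :
  separable_measure mu.
Proof.
have [compactX dissipated] := dissipatedX.
suff : ess_countably_generated mu [set: borel_type X].
  move=> /ess_countably_generated_approximable[a [ma approx_a]].
  exact: approximable_separable_measure ma approx_a.
apply: contrapT => /nowhere_countably_generated_exists[H [mH H0 nH]].
have [K [g [[cK KH K0 cg] gK0]]] :=
  compact_atomless_map hausdorffX compactX regular_mu mH H0 nH.
have [Y [f [compactY cf tight_f [Gamma _ GammaE]]]] :=
  dissipated _ g (@unit_itv_compact R) cg.
have secondY : @second_countable Y.
  pose Y' : pseudoPMetricType R := HB.pack Y (isPointed.Build Y (f point)).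
  exact: (@compact_second_countable R Y' compactY).
apply: tight_f; apply: (@exists_strongly_c_loose R X Y hausdorffX mu regular_mu
  (@metric_hausdorff _ Y) secondY f cf K cK _ K0).
  exact: nowhere_countably_generatedS nH.
(* Off the range of [f] the fibre is empty. Otherwise [g] factors through [f] by [Gamma], so the
   fibre of [f] lies in the fibre of [g] through [x0], whose part in [K] is null. *)
move=> y; have [[x0 fx0]|nfy] := pselect (exists x, f x = y); last first.
  apply: negligibleS (negligible_set0 mu) => x [_ fx].
  by apply: nfy; exists x.
apply: negligibleS (gK0 (g x0)) => x [Kx fx]; split => //=.
rewrite !GammaE; congr (set_val (Gamma _)); apply: val_inj => /=.
by rewrite fx0.
Qed.
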